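(* Let $D\subsetneq\mathbb{C}^N$ be any given logarithmically convex complete Reinhardt domain with its logarithmic image denoted by $G=\lambda(D)$. Let $h$ denote the support function of the convex domain $G\subset\mathbb{R}^N$, with $PS_h$ denoting its normalized effective domain. Let $\{\alpha^n : n\in\mathbb{N}\}$ be any given countable dense subset of $PS_h$. Pick any doubly-indexed sequence $\{J^{nk} : n,k\in\mathbb{N}\}$ of distinct points from $\mathbb{N}_0^N\setminus\{0\}$ with the property that for each $n\in\mathbb{N}$, $\pi(J^{nk})\to\alpha^n$ as $k\to\infty$ (such a sequence always exists). Then, for each $n\in\mathbb{N}$, the elementary power series with positive coefficients given by $$f_n(z)=\sum_{k\in\mathbb{N}} c_{nk}z^{J^{nk}},\qquad c_{nk}=e^{-|J^{nk}|h(\alpha^n)},$$ has the logarithmic image of its domain of convergence equal to a supporting half-space of $G$; in particular, the $f_n$ all converge absolutely on $D$. Furthermore, their sum $$f(z)=\sum_n f_n(z)=\sum_{n,k\in\mathbb{N}}c_{nk}z^{J^{nk}},$$ which is indeed a power series by the distinctness of the $J^{nk}$'s (no like terms have to be combined), converges absolutely and uniformly on $D$, and $D$ is the domain of convergence of the power series $f$.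
   Context: Notation. $\mathbb{N}_0=\mathbb{N}\cup\{0\}$. For $x\in\mathbb{R}^N$, $|x|$ denotes the $l^1$-norm; for $J\in\mathbb{N}_0^N$, $|J|=j_1+\dots+j_N$. $S_N$ is the unit sphere of the $l^1$-norm on $\mathbb{R}^N$, $PS_N=\{x\in\mathbb{R}^N: x_1+\dots+x_N=1,\ x_j\ge 0 \text{ for all } j\}$, and $\pi:\mathbb{R}^N\setminus\{0\}\to S_N$ is $\pi(x)=x/|x|$. The domain of convergence of a power series $\sum_{J\in\mathbb{N}_0^N} c_Jz^J$ is the interior of the set of points of $\mathbb{C}^N$ at which the series converges absolutely. $\lambda(z)=(\log|z_1|,\dots,\log|z_N|)$, defined for $z$ with no zero coordinate; the logarithmic image $\lambda(D)$ is the image under $\lambda$ of the points of $D$ with no zero coordinate. A domain $D\subset\mathbb{C}^N$ (assumed non-empty) is complete Reinhardt if it is a union of open polydiscs centered at the origin; it is logarithmically convex if $\lambda(D)\subset\mathbb{R}^N$ is convex. A power series is elementary if the logarithmic image of its domain of convergence is a half-space in $\mathbb{R}^N$ or $\mathbb{R}^N$ itself. The support function of a convex set $G\subset\mathbb{R}^N$ is $h_G(u)=\sup\{\langle x,u\rangle: x\in G\}\in(-\infty,\infty]$; its normalized effective domain is $\{\alpha\in S_N: h_G(\alpha)\text{ is finite}\}$. For $G$ the logarithmic image of a logarithmically convex complete Reinhardt domain this set is contained in $PS_N$ and is denoted $PS_h$. The supporting half-space of $G$ with normal vector $\alpha\in PS_h$ is $\{s\in\mathbb{R}^N: \langle\a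lpha,s\rangle-h_G(\alpha)<0\}$.
   Formalization: For convergence of f on D and D being its domain of convergence, it is additionally assumed that for each e>0 only finitely many pairs (n,k) have |π(J^{nk})−α^n| ≥ e (otherwise false); uniform convergence is on compact subsets of D, since it fails on all of the unit disc. *)

(* Defs.v *)
From HB Require Import structures.
From mathcomp Require Import all_boot all_order all_algebra finmap.
From mathcomp Require Import all_classical all_reals all_analysis.
From mathcomp Require Import complex.
From mathcomp Require showcase.summability.
Set Implicit Arguments.
Unset Strict Implicit.
Unset Printing Implicit Defensive.
Import Order.TTheory GRing.Theory Num.Theory.
Import numFieldNormedType.Exports.
Local Open Scope classical_set_scope.
Local Open Scope ring_scope.
Local Open Scope complex_scope.

(* The regular module [R[i]^o] is what carries the usual topology of the
   complex plane; [Normc.normc] is the modulus with values in [R]. *)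
Notation Cspace R N := 'rV[(R[i])^o]_N.
Notation multi_index N := {ffun 'I_N -> nat}.

Section RealSide.
Context {R : realType} {N : nat}.
Implicit Types (x u a : 'rV[R]_N) (G : set 'rV[R]_N).

Definition dot x u : R := \sum_i x 0 i * u 0 i.

Definition l1norm x : R := \sum_i `|x 0 i|.

Definition l1proj x : 'rV[R]_N := (l1norm x)^-1 *: x.

Definition l1sphere : set 'rV[R]_N := [set x | l1norm x = 1].

Definition support_function G u : \bar R :=
  ereal_sup [set (dot x u)%:E | x in G].

Definition normalized_eff_domain (h : 'rV[R]_N -> \bar R) : set 'rV[R]_N :=
  l1sphere `&` [set a | h a \is a fin_num].

Definition supporting_half_space_at G a : set 'rV[R]_N :=
  [set s | ((dot a s)%:E - support_function G a < 0)%E].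

Definition supporting_half_space G (H : set 'rV[R]_N) :=
  exists2 a, normalized_eff_domain (support_function G) a
           & H = supporting_half_space_at G a.

Definition half_space (H : set 'rV[R]_N) :=
  exists a (b : R), a != 0 /\ H = [set s | dot a s < b].

Definition mdeg (J : multi_index N) : nat := (\sum_i J i)%N.

Definition mvec (J : multi_index N) : 'rV[R]_N := \row_i (J i)%:R.

End RealSide.

Section ComplexSide.
Context {R : realType} {N : nat}.
Implicit Types (z : Cspace R N) (D : set (Cspace R N)).

Definition polydisc (r : 'rV[R]_N) : set (Cspace R N) :=
  [set z | forall i, Normc.normc (z 0 i) < r 0 i].

Definition is_domain D := [/\ D !=set0, open D & connected D].

Definition complete_reinhardt D :=
  exists2 P : set 'rV[R]_N, (forall r, P r -> forall i, 0 < r 0 i)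
    & D = \bigcup_(r in P) polydisc r.

Definition log_image D : set 'rV[R]_N :=
  [set \row_i ln (Normc.normc (z 0 i)) | z in D `&` [set z | forall i, z 0 i != 0]].

Definition log_convex D := convex_set (log_image D).

Definition monom z (J : multi_index N) : (R[i])^o := \prod_i z 0 i ^+ J i.

Definition pseries := multi_index N -> R[i].

Definition abs_converges (c : pseries) z :=
  (\esum_(J in [set: multi_index N]) (Normc.normc (c J * monom z J))%:E < +oo)%E.

Definition domain_of_convergence (c : pseries) : set (Cspace R N) :=
  [set z | abs_converges c z]°.

Definition elementary (c : pseries) :=
  let H := log_image (domain_of_convergence c) in half_space H \/ H = setT.

(* Unordered sum: the limit along the directed set of finite sets of
   multi-indices. *)
Definition pseries_sum (c : pseries) z : (R[i])^o :=
  summability.sum (fun J => c J * monom z J : (R[i])^o).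

(* The power series with terms [c i * z ^ E i], [i : I]: like terms are
   collected. The fibres of [E] must be finite, since a sum over an infinite
   support is 0 by convention; below [E] is injective, so that the coefficient
   of [z ^ E i] is [c i]. *)
Definition pseries_of {I : choiceType} (E : I -> multi_index N) (c : I -> R) :
  pseries := fun M => \sum_(i \in E @^-1` [set M]) (c i)%:C.

Definition finite_partial_sum {I : choiceType} (E : I -> multi_index N)
    (c : I -> R) (A : {fset I}) : Cspace R N -> (R[i])^o :=
  fun z => \sum_(i <- A) (c i)%:C * monom z (E i).

End ComplexSide.
Arguments pseries : clear implicits.

Section DoubleSequences.
Context {R : realType} {N : nat}.
Variables (alpha : nat -> 'rV[R]_N) (J : nat -> nat -> multi_index N).

Definition admissible :=
  [/\ (forall n k n' k', J n k = J n' k' -> n = n' /\ k = k'),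
      (forall n k, J n k != [ffun=> 0%N])
    & (forall n, (fun k => l1proj (mvec (J n k))) @ \oo --> alpha n)].

(* [l1proj (J n k) - alpha n] tends to 0 along the cofinite filter of pairs
   (n, k). Convergence for each fixed n does not control the terms of small k
   and large n, and the total series may then diverge in the domain: on the
   bidisc |z_1| < 1, |z_2| < 2 it does if J n 0 = (0, m_n), with m_n tending to
   infinity, for the infinitely many n such that the second coordinate of
   alpha n is less than 1/2. Dropping finitely many terms of each component
   series always yields this condition. *)
Definition jointly_convergent :=
  forall e : R, 0 < e -> finite_set
    [set p : nat * nat | e <= l1norm (l1proj (mvec (J p.1 p.2)) - alpha p.1)].

Definition coef (h : 'rV[R]_N -> \bar R) (n k : nat) : R :=
  expR (- ((mdeg (J n k))%:R * fine (h (alpha n)))).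

Definition component_series h (n : nat) : pseries R N := pseries_of (J n) (coef h n).

Definition total_series h : pseries R N :=
  pseries_of (fun p : nat * nat => J p.1 p.2) (fun p => coef h p.1 p.2).

End DoubleSequences.

(* Main.v *)
(* A point z with |z_i| <= e^{s_i} satisfies
   |c_nk z^J| <= exp (|J| (<pi J, s> - h (alpha n))) for J = J n k, with equality
   when |z_i| = e^{s_i}. Along k -> oo the bracket tends to
   <alpha n, s> - h (alpha n), so f_n converges when this is negative (comparison
   with the convergent series of all q^|J|, q < 1) and its terms stay above 1
   when it is positive. As G = lambda(D) is open and stable under lowering
   coordinates, a point s of G has a gap e > 0 with <a, s> + e <= h a for all a
   in the effective domain; joint convergence then leaves only finitely many
   pairs (n, k) outside the geometric bound with e / 2, locally uniformly on D.
   Conversely, convergence of f at e^s forces <alpha n, s> <= h (alpha n) for all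
   n; a point lambda-below s outside G would be separated from G by a supporting
   functional a with h a < <a, s>, and density of the alpha n excludes this. *)
Require Import Defs.
From mathcomp Require Import all_boot all_order all_algebra finmap.
From mathcomp Require Import all_classical all_reals all_analysis.
From mathcomp Require Import complex.
From mathcomp Require showcase.summability.
From mathcomp Require Import ring lra zify.
Set Implicit Arguments.
Unset Strict Implicit.
Unset Printing Implicit Defensive.
Import Order.TTheory GRing.Theory Num.Theory.
Import numFieldNormedType.Exports.
Local Open Scope classical_set_scope.
Local Open Scope ring_scope.

#[local] Existing Instance summability.totally_filter.

Local Notation normc := Normc.normc.

(** * Pairings with nonnegative functionals and the gap below the support function *)

Section RealSide.
Context {R : realType} {N : nat}.
Implicit Types (x y s a u : 'rV[R]_N) (G : set 'rV[R]_N).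

Lemma dotC x y : dot x y = dot y x.
Proof. by apply: eq_bigr => i _; rewrite mulrC. Qed.

Lemma dotDl x y a : dot (x + y) a = dot x a + dot y a.
Proof. by rewrite -big_split; apply: eq_bigr => i _; rewrite !mxE mulrDl. Qed.

Lemma dotZl t x a : dot (t *: x) a = t * dot x a.
Proof. by rewrite mulr_sumr; apply: eq_bigr => i _; rewrite !mxE mulrA. Qed.

Lemma dotNl x a : dot (- x) a = - dot x a.
Proof. by rewrite -scaleN1r dotZl mulN1r. Qed.

Lemma dotBl x y a : dot (x - y) a = dot x a - dot y a.
Proof. by rewrite dotDl dotNl. Qed.

Lemma dotDr a x y : dot a (x + y) = dot a x + dot a y.
Proof. by rewrite dotC dotDl !(dotC _ a). Qed.

Lemma dotZr t a x : dot a (t *: x) = t * dot a x.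
Proof. by rewrite dotC dotZl (dotC _ a). Qed.

Lemma dotBr a x y : dot a (x - y) = dot a x - dot a y.
Proof. by rewrite dotC dotBl !(dotC _ a). Qed.

Lemma dot_mulmx m x (w : 'rV[R]_m) (V : 'M[R]_(m, N)) :
  dot x (w *m V) = \sum_i w 0 i * dot x (row i V).
Proof.
rewrite /dot; under [RHS]eq_bigr do rewrite mulr_sumr.
rewrite exchange_big; apply: eq_bigr => j _ /=.
by rewrite mxE mulr_sumr; apply: eq_bigr => i _; rewrite mxE mulrCA.
Qed.

Lemma dotxx_ge0 x : 0 <= dot x x.
Proof. by apply: sumr_ge0 => i _; rewrite -expr2 sqr_ge0. Qed.

Lemma dotxx_eq0 x : dot x x = 0 -> x = 0.
Proof.
move=> /eqP; rewrite psumr_eq0 => [/allP x0|i _]; last by rewrite -expr2 sqr_ge0.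
apply/rowP => i; have := x0 i (mem_index_enum _).
by rewrite -expr2 sqrf_eq0 mxE => /eqP.
Qed.

Lemma l1norm_ge0 x : 0 <= l1norm x.
Proof. exact: sumr_ge0. Qed.

Lemma l1norm_eq0 x : l1norm x = 0 -> x = 0.
Proof.
move=> /eqP; rewrite psumr_eq0 // => /allP x0; apply/rowP => i.
by have := x0 i (mem_index_enum _); rewrite normr_eq0 mxE => /eqP.
Qed.

Lemma l1normZ t x : l1norm (t *: x) = `|t| * l1norm x.
Proof. by rewrite mulr_sumr; apply: eq_bigr => i _; rewrite mxE normrM. Qed.

Lemma dot_le_norm x y : `|dot x y| <= l1norm x * l1norm y.
Proof.
apply: le_trans (ler_norm_sum _ _ _) _; rewrite mulr_suml; apply: ler_sum => i _.
rewrite normrM ler_wpM2l // /l1norm (bigD1 i) //= lerDl; exact: sumr_ge0.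
Qed.

Definition lower_set G := forall x y, G x -> (forall i, y 0 i <= x 0 i) -> G y.

(** Room in the diagonal direction: along [const_mx e] every nonnegative functional of l1-norm 1
    gains exactly [e]. *)
Definition up_open G := forall x, G x -> exists2 e : R, 0 < e & G (x + const_mx e).

Local Notation PSh G := (normalized_eff_domain (support_function G)).

Lemma support_function_ub G a x :
  support_function G a \is a fin_num -> G x ->
  dot x a <= fine (support_function G a).
Proof.
by move=> fh Gx; rewrite -lee_fin fineK //; apply: ereal_sup_ubound; exists x.
Qed.

(** Nonemptiness excludes the value -oo and the bound excludes +oo. This is how the support function
    is shown to be finite at new vectors. *)
Lemma support_function_le G a b : G !=set0 -> (forall x, G x -> dot x a <= b) ->
  support_function G a \is a fin_num /\ fine (support_function G a) <= b.
Proof.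
move=> [x0 Gx0] Gb.
have hb : (support_function G a <= b%:E)%E.
  by apply: ge_ereal_sup => _ [x Gx <-]; rewrite lee_fin Gb.
have hl : ((dot x0 a)%:E <= support_function G a)%E.
  by apply: ereal_sup_ubound; exists x0.
have hf : support_function G a \is a fin_num.
  rewrite fin_numE; apply/andP; split.
    by apply/eqP => h0; rewrite h0 in hl.
  by apply/eqP => h0; rewrite h0 in hb.
by split => //; rewrite -lee_fin fineK.
Qed.

Lemma supporting_half_space_atE G a : support_function G a \is a fin_num ->
  supporting_half_space_at G a = [set s | dot a s < fine (support_function G a)].
Proof.
move=> /fineK; set b := fine _ => hb; rewrite /supporting_half_space_at -hb.
by apply/funext => s /=; rewrite -EFinB lte_fin subr_lt0.
Qed.

(** If [a 0 i] were negative, lowering the [i]-th coordinate of a point of [G] would stay in [G] and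
    make the pairing with [a] unbounded. *)
Lemma eff_domain_ge0 G a i : G !=set0 -> lower_set G -> PSh G a -> 0 <= a 0 i.
Proof.
move=> [x0 Gx0] Glow [_ ha]; rewrite leNgt; apply/negP => ai.
have h0 := support_function_ub ha Gx0.
set b := fine _ in h0.
(* With this [M] the lowered point pairs with [a] to exactly [b + 1]. *)
pose M := (b - dot x0 a + 1) / (- a 0 i).
have M0 : 0 <= M by rewrite divr_ge0 //; lra.
have : dot (x0 - M *: delta_mx 0 i) a <= b.
  apply: support_function_ub => //; apply: Glow Gx0 _ => j.
  by rewrite !mxE lerBlDr lerDl mulr_ge0.
rewrite dotBl dotZl {2}/dot (bigD1 i) //= big1 ?addr0 => [|j ji]; last first.
  by rewrite mxE (negbTE ji) andbF mul0r.
rewrite mxE !eqxx mul1r.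
have -> : M * a 0 i = - (b - dot x0 a + 1).
  by rewrite /M invrN mulrN mulNr divfK ?lt_eqF.
lra.
Qed.

Lemma l1norm_nneg a : (forall i, 0 <= a 0 i) -> l1norm a = \sum_i a 0 i.
Proof. by move=> a0; apply: eq_bigr => i _; rewrite ger0_norm. Qed.

Lemma dot_const a e : (forall i, 0 <= a 0 i) -> dot (const_mx e) a = e * l1norm a.
Proof.
by move=> a0; rewrite l1norm_nneg // mulr_sumr; apply: eq_bigr => i _; rewrite mxE.
Qed.

(** The gap is the diagonal room above [s], so one [e] serves all [a] at once; the summation over
    all pairs [(n, k)] rests on this uniformity. *)
Lemma eff_domain_gap G s : lower_set G -> up_open G -> G s ->
  exists2 e : R, 0 < e &
    forall a, PSh G a -> dot a s + e <= fine (support_function G a).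
Proof.
move=> Glow Gup Gs; have [e e0 Gse] := Gup s Gs; exists e => // a aG.
have a0 i : 0 <= a 0 i by apply: eff_domain_ge0 Glow aG; exists s.
case: (aG) => al1 /support_function_ub/(_ Gse).
by rewrite dotDl dot_const // al1 mulr1 dotC.
Qed.

Lemma row_lt_gap x y : (forall i, x 0 i < y 0 i) ->
  exists2 e : R, 0 < e & forall i, x 0 i + e <= y 0 i.
Proof.
(* The starting value 1 keeps the minimum positive when there are no coordinates. *)
move=> xy; exists (\big[Num.min/1]_i (y 0 i - x 0 i)).
  by apply: lt_bigmin => // i _; rewrite subr_gt0.
by move=> i; rewrite -lerBrDl; exact: bigmin_le_cond.
Qed.

Lemma dot_lt a x y : (forall i, 0 <= a 0 i) -> l1norm a = 1 ->
  (forall i, x 0 i < y 0 i) -> dot a x < dot a y.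
Proof.
move=> a0 a1 /row_lt_gap[e e0 xy].
have : dot a (x + const_mx e) <= dot a y.
  by apply: ler_sum => i _; rewrite !mxE ler_wpM2l.
by rewrite dotDr (dotC a (const_mx _)) dot_const // a1; lra.
Qed.

End RealSide.

(** * Separation of convex sets, and support bounds from a dense set of directions *)

Section SupportFunction.
Context {R : realType} {N : nat}.
Implicit Types (x y s a u : 'rV[R]_N) (G : set 'rV[R]_N).
Local Notation PSh G := (normalized_eff_domain (support_function G)).

Lemma continuous_dotxx p : continuous (fun x => dot (x - p) (x - p)).
Proof.
apply: continuous_big => [|i _ x]; first exact: add_continuous.
have -> : (fun y => (y - p) 0 i * (y - p) 0 i) = (fun y => (y 0 i - p 0 i) * (y 0 i - p 0 i)).
  by apply/funext => y; rewrite !mxE.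
have cB : (fun y : 'rV[R]_N => y 0 i - p 0 i) @ x --> x 0 i - p 0 i.
  by apply: (@cvgB R R^o _ (nbhs x)); [exact: coord_continuous|exact: cvg_cst].
exact: (@cvgM R _ (nbhs x) _ _ _ _ _ cB cB).
Qed.

Lemma dot_sqrB t x y :
  dot (t *: x - y) (t *: x - y) = t ^+ 2 * dot x x - 2 * t * dot x y + dot y y.
Proof. by rewrite dotBl !dotBr !dotZl !dotZr (dotC y x); ring. Qed.

Lemma convex_comb G (G_convex : convex_set G) x y (t : R) :
  0 <= t <= 1 -> G x -> G y -> G (x + t *: (y - x)).
Proof.
move=> t01 Gx Gy; have t01' : t \in `[0, 1] by rewrite in_itv.
have := G_convex y x (Itv01 (andP t01).1 (andP t01).2).
rewrite !inE => /(_ Gy Gx).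
congr (G _).
transitivity (t *: y + (1 - t) *: x : 'rV_N); first by [].
by apply/rowP => i; rewrite !mxE; ring.
Qed.

Lemma closure_convex_comb G (G_convex : convex_set G) x y (t : R) :
  0 <= t <= 1 -> closure G x -> closure G y -> closure G (x + t *: (y - x)).
Proof.
move=> t01 cx cy B /nbhs_ballP[e /= e0 eB].
have [x' [Gx' xx']] := cx _ (nbhsx_ballx x e e0).
have [y' [Gy' yy']] := cy _ (nbhsx_ballx y e e0).
exists (x' + t *: (y' - x')); split; first exact: convex_comb.
apply: eB; move: xx' yy'; rewrite -!ball_normE /= => xx' yy'.
have -> : x + t *: (y - x) - (x' + t *: (y' - x')) =
          (1 - t) *: (x - x') + t *: (y - y').
  by apply/rowP => i; rewrite !mxE; ring.
apply: le_lt_trans (ler_normD _ _) _; rewrite !normrZ.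
case/andP: t01 => t0 t1.
rewrite ger0_norm ?subr_ge0 // (ger0_norm t0).
set A := `|x - x'| in xx' *; set B' := `|y - y'| in yy' *.
have [->|t1'] := eqVneq t 1; first by rewrite subrr mul0r add0r mul1r.
have : 0 < 1 - t by rewrite subr_gt0 lt_neqAle t1'.
by move=> h; nra.
Qed.

(** The normal is [p - c], where [c] is a point of [closure G] nearest to [p] in the Euclidean
    distance. *)
Lemma nearest_point_separation G (G_convex : convex_set G) p :
  G !=set0 -> ~ closure G p ->
  exists a : 'rV[R]_N, a != 0 /\ exists2 b, b < dot p a & forall x, G x -> dot x a <= b.
Proof.
move=> [x0 Gx0] pG; set f := fun x => dot (x - p) (x - p).
(* Cutting by the Euclidean ball around [p] through [x0] gives compactness without losing the
   nearest point. *)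
set C := closure G `&` [set x | f x <= f x0].
have Cx0 : C x0 by split => /=; first exact: subset_closure.
have Ccl : closed C.
  apply: closedI; first exact: closed_closure.
  apply: (@preimage_closed _ _ f [set y | y <= f x0]); last exact: closed_le.
  by move=> x _; exact: continuous_dotxx.
have Cbd : bounded_set C.
  exists (1 + f x0 + `|p|); split; first exact: num_real.
  move=> M hM x [_ fx]; apply: le_trans (ltW hM).
  rewrite -(subrK p x); apply: le_trans (ler_normD _ _) _; rewrite lerD2r.
  rewrite [leLHS]/Num.norm /= mx_normrE; apply/bigmax_leP; split => [|[i j] _ /=].
    by rewrite addr_ge0 //; exact: dotxx_ge0.
  have h : (x - p) i j ^+ 2 <= f x0.
    apply: le_trans fx; rewrite /f [leRHS]/dot (bigD1 j) //= ord1 -expr2 lerDl.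
    by apply: sumr_ge0 => k _; rewrite -expr2 sqr_ge0.
  rewrite -real_normK ?num_real // in h.
  by set q := `|_ i j| in h *; nra.
have Ccp := bounded_closed_compact Cbd Ccl.
have [c] := EVT_min_rV (ex_intro _ _ Cx0) Ccp
  (continuous_subspaceT (@continuous_dotxx p)).
rewrite inE => -[cG fc] cmin.
have cmin' x : closure G x -> f c <= f x.
  move=> xG; have [fx|/ltW fx] := leP (f x) (f x0).
    by apply: cmin; rewrite inE.
  exact: le_trans fc fx.
exists (p - c); have pc : p - c != 0.
  by apply: contra_not_neq pG => /subr0_eq ->.
split => //; exists (dot c (p - c)).
  rewrite -subr_gt0 -dotBl lt_neqAle dotxx_ge0 andbT eq_sym.
  by apply: contra_neq pc => /dotxx_eq0.
move=> x Gx; rewrite -subr_le0 -dotBl.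
set q := dot (x - c) (x - c); have q0 : 0 <= q := dotxx_ge0 _.
rewrite leNgt; apply/negP => d0; set d := dot _ _ in d0.
(* Minimality of [c] against the points of the segment from [c] to [x]. *)
have key (t : R) : 0 <= t <= 1 -> 2 * t * d <= t ^+ 2 * q.
  move=> t01; have := cmin' _ (closure_convex_comb G_convex t01 cG (subset_closure Gx)).
  rewrite /f.
  have -> : c + t *: (x - c) - p = t *: (x - c) - (p - c).
    by apply/rowP => i; rewrite !mxE; ring.
  have -> : c - p = - (p - c) by rewrite opprB.
  rewrite dotNl (dotC _ (- _)) dotNl opprK.
  by rewrite dot_sqrB -/q -/d; lra.
(* For this [t] one has [t * q < d], whereas [key] gives [2 * d <= t * q]. *)
pose t := d / (d + q + 1); have dq : 0 < d + q + 1 by lra.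
have t0 : 0 < t by rewrite divr_gt0.
have t1 : t <= 1 by rewrite ler_pdivrMr // mul1r; lra.
have := key t; rewrite (ltW t0) t1 => /(_ isT).
have : t * (d + q + 1) = d by rewrite divfK // gt_eqF.
nra.
Qed.

(** As [s] may lie in the closure of [G], separation is applied to [s + const_mx e]: a point of [G]
    within [e] of it would dominate [s] and force [s] into [G]. The separating functional is then
    normalised. *)
Lemma supporting_functional G (G_convex : convex_set G) s (e : R) :
  G !=set0 -> lower_set G -> ~ G s -> 0 < e ->
  exists2 a, PSh G a & fine (support_function G a) < dot a s + e.
Proof.
move=> G0 Glow Gs e0.
have [|a [a0 [b pb Gb]]] := nearest_point_separation (p := s + const_mx e) G_convex G0.
  move=> /(_ _ (nbhsx_ballx _ e e0))[g [Gg [_ gs]]]; apply: Gs.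
  apply: Glow Gg _ => i; have := gs 0 i.
  by rewrite /ball_ /ball /= !mxE ltr_distlC => /andP[+ _]; rewrite addrK => /ltW.
have la : 0 < l1norm a.
  by rewrite lt_neqAle l1norm_ge0 andbT eq_sym; apply: contra_neq a0 => /l1norm_eq0.
have [|ha1 ha2] := @support_function_le _ _ G (l1proj a) ((l1norm a)^-1 * b) G0.
  by move=> x Gx; rewrite dotC dotZl dotC ler_pM2l ?invr_gt0 // Gb.
have an : PSh G (l1proj a).
  by split => //; rewrite /l1sphere /= l1normZ ger0_norm ?invr_ge0 ?ltW // mulVf ?gt_eqF.
exists (l1proj a) => //; apply: (le_lt_trans ha2).
have : dot (s + const_mx e) (l1proj a) = dot (l1proj a) s + e.
  case: (an) => /= l1 _; rewrite dotDl dotC dot_const ?l1 ?mulr1 // => i.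
  exact: eff_domain_ge0 Glow an.
by move=> <-; rewrite dotZr ltr_pM2l ?invr_gt0.
Qed.

(* The support function is only lower semicontinuous, so the inequality does not
   pass to limits of the [alpha n] directly. If it fails at [a], convexity makes
   it fail on a full neighbourhood, relative to the span of the effective
   domain, of a point close to [a] on the segment from [a] to the barycentre of
   a spanning family; this neighbourhood contains some [alpha n]. *)
Lemma dense_support_bound G (alpha : nat -> 'rV[R]_N) s :
  G !=set0 -> lower_set G ->
  range alpha `<=` PSh G -> PSh G `<=` closure (range alpha) ->
  (forall n, dot (alpha n) s <= fine (support_function G (alpha n))) ->
  forall a, PSh G a -> dot a s <= fine (support_function G a).
Proof.
move=> G0 Glow alphaG alphad alphas a aG.
set h := support_function G in aG *.
(* The rows of [V] are chosen in the effective domain with maximal rank; a vector of the domain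
   outside their span would raise the rank. *)
have [m [V [VG Vspan]]] : exists m (V : 'M[R]_(m.+1, N)),
    (forall i, PSh G (row i V)) /\ forall y, PSh G y -> (y <= V)%MS.
  pose P r := `[< exists m (V : 'M[R]_(m.+1, N)),
    (forall i, PSh G (row i V)) /\ \rank V = r >].
  have exP : exists r, P r.
    exists (\rank a); apply/asboolP; exists 0%N, a; split => // i.
    by rewrite ord1 row_id.
  have Pb r : P r -> (r <= N)%N.
    by move=> /asboolP[m [V [_ <-]]]; exact: rank_leq_col.
  have [r /asboolP[m [V [VG Vr]]] rmax] := ex_maxnP exP Pb.
  exists m, V; split => // y yG; apply/negPn/negP => yV.
  have : (\rank V < \rank (col_mx V y))%N.
    apply: rank_ltmx; rewrite ltmxE col_mx_sub submx_refl yV andbT.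
    by rewrite -addsmxE addsmxSl.
  rewrite Vr ltnNge => /negP; apply; apply: rmax; apply/asboolP.
  exists (m + 1)%N, (col_mx V y); split => // i.
  rewrite -[(m + 1).+1]/(m.+1 + 1)%N in i *.
  by case: (split_ordP i) => j ->; rewrite ?rowKu ?rowKd // ord1 row_id.
have nneg y : PSh G y -> forall i, 0 <= y 0 i.
  by move=> yG i; exact: eff_domain_ge0 Glow yG.
rewrite leNgt; apply/negP => ga.
pose g y := fine (h y) - dot y s.
(* Since [h] is convex and positively homogeneous, [g] is sublinear on nonnegative combinations of
   [a] and the rows of [V]; finiteness of [h] comes along. *)
have comb (t : R) (w : 'rV[R]_m.+1) y : 0 <= t <= 1 -> (forall i, 0 <= w 0 i) ->
    y = (1 - t) *: a + w *m V ->
    h y \is a fin_num /\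
    g y <= (1 - t) * g a + \sum_i w 0 i * g (row i V).
  move=> /andP[t0 t1] w0 yE.
  have [|hy hyle] := @support_function_le _ _ G y
      ((1 - t) * fine (h a) + \sum_i w 0 i * fine (h (row i V))) G0.
    move=> x Gx; rewrite yE dotDr dotZr dot_mulmx lerD //.
      by rewrite ler_wpM2l ?subr_ge0 //; apply: support_function_ub Gx; case: aG.
    apply: ler_sum => i _; rewrite ler_wpM2l //.
    by apply: support_function_ub Gx; case: (VG i).
  split => //; rewrite /g {2}yE [dot (_ + _) s]dotC dotDr dotZr dot_mulmx.
  under [X in _ <= _ + X]eq_bigr do rewrite mulrBr [dot (row _ _) _]dotC.
  by rewrite sumrB (dotC a s); rewrite -/(h y) in hyle; lra.
(* Rows entering with weights at most [2 * w0] will contribute at most [t * B]. As [t <= 1 / 2] and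
   [4 * (t * B) <= - g a], the bound on [g] near [c] is at most [g a / 4], which is negative. *)
pose B := 1 + 2 * \sum_i `|g (row i V)|.
have B0 : 0 < B by rewrite ltr_wpDr // mulr_ge0 // sumr_ge0.
have ga0 : g a < 0 by rewrite subr_lt0.
pose t := Num.min (1 / 2) (- g a / (4 * B)).
have t0 : 0 < t by rewrite lt_min !divr_gt0 ?mulr_gt0 // oppr_gt0.
have t12 : t <= 1 / 2 by rewrite ge_min lexx.
have tB : 4 * (t * B) <= - g a.
  have : t <= - g a / (4 * B) by rewrite ge_min lexx orbT.
  by rewrite ler_pdivlMr ?mulr_gt0 // => ?; lra.
have t01 : 0 <= t <= 1 by rewrite ltW //=; lra.
pose w0 := t / m.+1%:R.
have w00 : 0 < w0 by rewrite divr_gt0.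
pose c := (1 - t) *: a + const_mx w0 *m V.
have cG : PSh G c.
  have [|hc _] := comb t (const_mx w0) c t01 _ erefl.
    by move=> i; rewrite mxE ltW.
  split => //; rewrite /l1sphere /= -[RHS](_ : (1 - t) * 1 + t = 1); last ring.
  have c0 i : 0 <= c 0 i.
    rewrite mxE addr_ge0 // mxE.
      by rewrite mulr_ge0 ?nneg // subr_ge0; case/andP: t01.
    apply: sumr_ge0 => j _; rewrite mxE mulr_ge0 ?(ltW w00) //.
    by have := nneg _ (VG j) i; rewrite mxE.
  (* On nonnegative vectors the l1-norm is the linear functional [const_mx 1], hence is preserved by
     combinations with weights of sum 1. *)
  have dot1 y : PSh G y -> dot (const_mx 1) y = 1.
    by move=> yG; rewrite dot_const ?mul1r; [case: yG|exact: nneg].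
  rewrite -[LHS]mul1r -dot_const // dotDr dotZr dot_mulmx dot1 //; congr (_ + _).
  under eq_bigr do rewrite mxE dot1 //.
  by rewrite sumr_const card_ord mulr1 -mulr_natr divfK.
(* [K] dominates the column sums of the moduli of the entries of [pinvmx V]: a point of the span
   within [w0 / K] of [c] is reached by changing each row weight [w0] by at most [w0], so the
   weights stay nonnegative. *)
pose K := 1 + \sum_i \sum_j `|pinvmx V i j|.
have K0 : 0 < K by rewrite ltr_wpDr // sumr_ge0 // => i _; rewrite sumr_ge0.
have eta0 : 0 < w0 / K by rewrite divr_gt0.
have [_ [[n _ <-] [_ nc]]] := alphad _ cG _ (nbhsx_ballx c _ eta0).
have nG : PSh G (alpha n) by apply: alphaG; exists n.
pose mu := (alpha n - c) *m pinvmx V.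
have muV : mu *m V = alpha n - c.
  by rewrite mulmxKpV // addmx_sub ?eqmx_opp ?Vspan.
have mu_small i : `|mu 0 i| <= w0.
  rewrite mxE; apply: le_trans (ler_norm_sum _ _ _) _.
  apply: (@le_trans _ _ (\sum_j w0 / K * `|pinvmx V j i|)).
    apply: ler_sum => j _; rewrite normrM ler_wpM2r //.
    by have := nc 0 j; rewrite /ball /= distrC !mxE => /ltW.
  rewrite -mulr_sumr mulrAC ler_pdivrMr // ler_pM2l // /K.
  apply: (@le_trans _ _ (\sum_i0 `|pinvmx V i0 i|)) => //.
  rewrite [X in _ <= _ + X]exchange_big /= (bigD1 i) //= addrCA lerDl.
  by rewrite addr_ge0 // sumr_ge0 // => j _; rewrite sumr_ge0.
have [||_ gn] := comb t (const_mx w0 + mu) (alpha n) t01.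
- move=> i; rewrite mxE [const_mx _ _ _]mxE.
  by have := mu_small i; rewrite ler_norml => /andP[]; lra.
- by rewrite mulmxDl muV addrA -/c addrC subrK.
have gn0 : 0 <= g (alpha n) by rewrite subr_ge0.
have : \sum_i (const_mx w0 + mu) 0 i * g (row i V) <= t * B.
  apply: (@le_trans _ _ (\sum_i 2 * w0 * `|g (row i V)|)).
    apply: ler_sum => i _; apply: le_trans (ler_norm _) _.
    rewrite normrM ler_wpM2r // mxE mxE; apply: le_trans (ler_normD _ _) _.
    by have := mu_small i; rewrite (gtr0_norm w00); lra.
  rewrite -mulr_sumr /B.
  have : w0 <= t.
    by rewrite ler_pdivrMr // ler_peMr ?(ltW t0) // ler1n.
  have : 0 <= \sum_i `|g (row i V)| by rewrite sumr_ge0.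
  by set S := \sum_i _ => S0 wt; nra.
nra.
Qed.

(** The slack [e] of the supporting functional is absorbed by the coordinatewise gap:
    [<a, s'> + e <= <a, s> <= h a] contradicts [h a < <a, s'> + e]. *)
Lemma dense_support_lower G (alpha : nat -> 'rV[R]_N) (G_convex : convex_set G) s s' :
  G !=set0 -> lower_set G ->
  range alpha `<=` PSh G -> PSh G `<=` closure (range alpha) ->
  (forall n, dot (alpha n) s <= fine (support_function G (alpha n))) ->
  (forall i, s' 0 i < s 0 i) -> G s'.
Proof.
move=> G0 Glow alphaG alphad alphas s's; apply: contrapT => Gs'.
have [e e0 es] := row_lt_gap s's.
have [a aG ha] := supporting_functional G_convex G0 Glow Gs' e0.
have := dense_support_bound G0 Glow alphaG alphad alphas aG.
have a0 i : 0 <= a 0 i by exact: eff_domain_ge0 Glow aG.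
have : dot a (s' + const_mx e) <= dot a s.
  by apply: ler_sum => i _; rewrite !mxE ler_wpM2l.
case: (aG) => /= a1 _; rewrite dotDr (dotC a (const_mx _)) dot_const // a1; lra.
Qed.
End SupportFunction.

(** * Unordered sums of nonnegative reals *)

Section Summation.
Context {R : realType}.

Lemma ler_sum_subset (T : eqType) (r s : seq T) (f : T -> R) :
  uniq r -> uniq s -> {subset r <= s} -> (forall x, 0 <= f x) ->
  \sum_(x <- r) f x <= \sum_(x <- s) f x.
Proof.
move=> ur us rs f0.
have -> : \sum_(x <- r) f x = \sum_(x <- [seq x <- s | x \in r]) f x.
  apply: perm_big; apply: uniq_perm; rewrite ?filter_uniq // => x.
  by rewrite mem_filter; case: (boolP (x \in r)) => // /rs ->.
by rewrite big_filter big_mkcond ler_sum // => x _; case: ifP.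
Qed.

Lemma esum_le_fin (I : choiceType) (f : I -> R) (b : R) : (forall i, 0 <= f i) ->
  (forall A : {fset I}, \sum_(i <- A) f i <= b) ->
  (\esum_(i in [set: I]) (f i)%:E <= b%:E)%E.
Proof.
move=> f0 fb; apply: ge_ereal_sup => _ [A [finA _] <-].
by rewrite fsbig_finite //= sumEFin lee_fin.
Qed.

Lemma sum_le_esum (I : choiceType) (f : I -> R) (A : {fset I}) :
  ((\sum_(i <- A) f i)%:E <= \esum_(i in [set: I]) (f i)%:E)%E.
Proof.
apply: ereal_sup_ubound; exists [set` A]; first by split.
by rewrite fsbig_finite //= set_fsetK sumEFin.
Qed.

(** A finite set of multi-indices lies in a box of side [m], over which the sum is the [N]-th power
    of a finite geometric sum. *)
Lemma esum_geometric (N : nat) (q : R) : 0 <= q < 1 ->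
  (\esum_(J in [set: {ffun 'I_N -> nat}]) (q ^+ mdeg J)%:E < +oo)%E.
Proof.
move=> /andP[q0 q1]; apply: (@le_lt_trans _ _ (((1 - q)^-1 ^+ N)%:E)); last first.
  exact: ltry.
apply: esum_le_fin => [J|A]; first exact: exprn_ge0.
pose m := (\max_(J <- A) \max_i J i).+1.
have Am J i : J \in A -> (J i < m)%N.
  move=> JA; rewrite ltnS; apply: leq_trans (leq_bigmax_seq J JA _) => //.
  exact: leq_bigmax.
pose emb (K : {ffun 'I_N -> 'I_m}) : {ffun 'I_N -> nat} := [ffun i => K i : nat].
have emb_inj : injective emb.
  by move=> K L /ffunP KL; apply/ffunP => i; apply: val_inj; have := KL i; rewrite !ffunE.
apply: (@le_trans _ _ (\sum_(J <- [seq emb K | K : {ffun 'I_N -> 'I_m}]) q ^+ mdeg J)).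
  apply: ler_sum_subset => //.
  - by rewrite map_inj_uniq // enum_uniq.
  - move=> J JA; apply/mapP; exists [ffun i => Ordinal (Am J i JA)].
      by rewrite mem_enum.
    by apply/ffunP => i; rewrite !ffunE.
  - by move=> J; exact: exprn_ge0.
rewrite big_map big_enum /=.
under eq_bigr do rewrite /mdeg expr_sum.
under eq_bigr do under eq_bigr do rewrite ffunE.
rewrite -(bigA_distr_bigA (fun _ (j : 'I_m) => q ^+ j)) /= prodr_const card_ord.
apply: lerXn2r; rewrite ?nnegrE ?invr_ge0 ?subr_ge0 ?(ltW q1) //.
  by apply: sumr_ge0 => i _; exact: exprn_ge0.
rewrite -[leRHS]mul1r ler_pdivlMr ?subr_gt0 //.
have := subrX1 q m; have := exprn_ge0 m q0; lra.
Qed.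

(** The finitely many exceptions are summed apart; injectivity of [E] bounds the rest by a part of
    the geometric series over all multi-indices. *)
Lemma esum_geometric_majorant (N : nat) (q : R) (I : choiceType)
    (E : I -> {ffun 'I_N -> nat}) (M : I -> R) :
  0 <= q < 1 -> injective E -> (forall i, 0 <= M i) ->
  finite_set [set i | q ^+ mdeg (E i) < M i] ->
  (\esum_(i in [set: I]) (M i)%:E < +oo)%E.
Proof.
move=> q01 Einj M0 finM; set B := [set i | _] in finM.
have q0 J : (0 <= (q ^+ @mdeg N J)%:E)%E.
  by rewrite lee_fin exprn_ge0 //; case/andP: q01.
have M0' i : (0 <= (M i)%:E)%E by rewrite lee_fin.
rewrite (esumID B) // setTI setTI lte_add_pinfty //.
  by rewrite esum_fset // fsbig_finite // sumEFin ltry.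
apply: le_lt_trans (esum_geometric N q01).
apply: (@le_trans _ _ (\esum_(i in ~` B) (q ^+ mdeg (E i))%:E)%E).
  by apply: le_esum => i /= /negP; rewrite lee_fin -leNgt.
have EB : set_inj (~` B) E by move=> i j _ _; exact: Einj.
rewrite -(@esum_image R _ _ (~` B) E (fun J => (q ^+ mdeg J)%:E) EB).
rewrite [leLHS]esum_mkcond; apply: le_esum => J _.
by case: ifP.
Qed.

Lemma esum_ge1_pinfty (I : choiceType) (M : I -> R) (g : nat -> I) (k0 : nat) :
  injective g -> (forall i, 0 <= M i) ->
  (forall k, (k0 <= k)%N -> 1 <= M (g k)) ->
  \esum_(i in [set: I]) (M i)%:E = +oo%E.
Proof.
move=> ginj M0 M1; apply/eqyP => A _.
pose n := (Num.truncn A).+1.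
apply: (@le_trans _ _ (\sum_(i <- [fset g (k0 + k)%N | k in iota 0 n]%fset) M i)%:E); last first.
  exact: sum_le_esum.
rewrite lee_fin big_imfset; last by move=> i j _ _ /ginj /addnI.
rewrite -[X in _ <= \sum_(i <- X) _]/(undup (iota 0 n)) undup_id ?iota_uniq // /=.
apply: (@le_trans _ _ (\sum_(k <- iota 0 n) 1)).
  rewrite big_const_seq count_predT size_iota iter_addr_0.
  by rewrite ltW // truncnS_gt.
rewrite ler_sum // => k _; apply: M1; exact: leq_addr.
Qed.
End Summation.

(** * Absolutely summable complex families *)

Section ComplexSums.
Local Open Scope complex_scope.
Local Notation Re := complex.Re.
Local Notation Im := complex.Im.
Context {R : realType}.
Local Notation C := (R[i]^o).

Lemma normc_ge0 (z : R[i]) : 0 <= normc z.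
Proof. by case: z => x y; exact: sqrtr_ge0. Qed.

Lemma normc_sum (T : Type) (r : seq T) (P : pred T) (f : T -> R[i]) :
  normc (\sum_(i <- r | P i) f i) <= \sum_(i <- r | P i) normc (f i).
Proof.
elim/big_ind2 : _ => // [|x1 x2 y1 y2 h1 h2]; first by rewrite Normc.normc0.
by apply: le_trans (le_normcD _ _) _; exact: lerD.
Qed.

Lemma normcB (x y : R[i]) : normc (x - y) = normc (y - x).
Proof. by rewrite -opprB normcN. Qed.

Lemma normcr (x : R) : normc x%:C = `|x|.
Proof. by rewrite /= expr0n addr0 sqrtr_sqr. Qed.

Lemma normcX (z : R[i]) n : normc (z ^+ n) = normc z ^+ n.
Proof. by elim: n => [|n IH]; rewrite ?Normc.normc1 // !exprS Normc.normcM IH. Qed.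

(** Bridge between the complex-valued norm of [R[i]^o] and the real modulus: a positive element of
    [R[i]] has zero imaginary part, so real radii suffice. *)
Lemma cvg_normcP (T : Type) (F : set_system T) {FF : Filter F} (f : T -> C) (l : C) :
  f @ F --> l <->
  forall e : R, 0 < e -> \forall x \near F, normc (l - f x) < e.
Proof.
split=> [/cvgrPdist_lt fl e e0|fl].
  have := fl e%:C; rewrite ltcR => /(_ e0).
  by apply: filterS => x; rewrite -ltcR.
apply/cvgrPdist_lt => e; rewrite ltcE => /= /andP[/eqP ei er].
apply: filterS (fl _ er) => x xl.
by rewrite ltcE /= ei eqxx.
Qed.

Lemma abs_Re_le (z : R[i]) : `|Re z| <= normc z.
Proof. by case: z => x y /=; rewrite -sqrtr_sqr ler_wsqrtr // lerDl sqr_ge0. Qed.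

Lemma abs_Im_le (z : R[i]) : `|Im z| <= normc z.
Proof. by case: z => x y /=; rewrite -sqrtr_sqr ler_wsqrtr // lerDr sqr_ge0. Qed.

Lemma normc_le (z : R[i]) : normc z <= `|Re z| + `|Im z|.
Proof.
case: z => x y /=; rewrite -[leRHS]ger0_norm ?addr_ge0 // -sqrtr_sqr.
rewrite ler_wsqrtr // sqrrD !real_normK ?num_real // lerD2r lerDl.
by rewrite mulrn_wge0 // mulr_ge0.
Qed.

(** Completeness is drawn from that of [R]: real and imaginary parts are 1-Lipschitz for the
    modulus. *)
Lemma cauchy_cvgC (T : Type) (F : set_system T) (FF : ProperFilter F) (f : T -> C) :
  (forall e : R, 0 < e -> exists x0, \forall x \near F, normc (f x0 - f x) < e) ->
  exists l : C, f @ F --> l.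
Proof.
move=> fc.
have part (p : R[i] -> R) : (forall x y, `|p x - p y| <= normc (x - y)) ->
    cvg (p \o f @ F).
  move=> pl; apply: cauchy_cvg; apply: cauchy_exP => e e0.
  have [x0 hx0] := fc e e0; exists (p (f x0)).
  by apply: filterS hx0 => x; apply: le_lt_trans; exact: pl.
have /cvg_ex[/= lr /cvgrPdist_lt cr] : cvg ((fun z => Re z) \o f @ F).
  by apply: part => -[x1 x2] [y1 y2]; exact: (abs_Re_le (_ +i* (x2 - y2))).
have /cvg_ex[/= li /cvgrPdist_lt ci] : cvg ((fun z => Im z) \o f @ F).
  by apply: part => -[x1 x2] [y1 y2]; exact: (abs_Im_le ((x1 - y1) +i* _)).
exists (lr +i* li); apply/cvg_normcP => e e0.
have e2 : 0 < e / 2 by rewrite divr_gt0.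
apply: filterS2 (cr _ e2) (ci _ e2) => x /= h1 h2.
apply: le_lt_trans (normc_le _) _; rewrite [ltRHS]splitr.
by case: (f x) h1 h2 => u v /= h1 h2; exact: ltrD.
Qed.

Section Family.
Context {I : choiceType}.
Implicit Types (a : I -> C) (M : I -> R).

Local Notation S a := (fun A : {fset I} => \sum_(i <- A) a i : C).

(** [A0] nearly attains the supremum defining the sum; a disjoint [B] with a larger sum would push
    the union above the total. *)
Lemma esum_tail M (e : R) : (forall i, 0 <= M i) ->
  (\esum_(i in [set: I]) (M i)%:E < +oo)%E -> 0 < e ->
  exists A0 : {fset I}, forall B : {fset I},
    [disjoint A0 & B]%fset -> \sum_(i <- B) M i <= e.
Proof.
move=> M0 Mfin e0.
have Mge0 : (0 <= \esum_(i in [set: I]) (M i)%:E)%E.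
  by apply: esum_ge0 => i _; rewrite lee_fin.
have Mnum : \esum_(i in [set: I]) (M i)%:E \is a fin_num by rewrite ge0_fin_numE.
have [_ [A [finA _] <-]] := ub_ereal_sup_adherent e0 Mnum.
rewrite fsbig_finite // sumEFin => hA.
exists (fset_set A) => B AB.
have := sum_le_esum M (fset_set A `|` B)%fset.
rewrite -/(esum _ _) -(fineK Mnum) in hA *.
rewrite -EFinB lte_fin in hA; rewrite lee_fin.
rewrite (_ : \sum_(i <- (fset_set A `|` B)%fset) M i =
  \sum_(i <- fset_set A) M i + \sum_(i <- B) M i); last first.
  rewrite -big_cat; apply: perm_big; apply: uniq_perm => //.
    by rewrite cat_uniq !fset_uniq /= andbT; apply/hasPn => x xB;
      apply/negP => xA; move/fdisjointP: AB => /(_ _ xA); rewrite xB.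
  by move=> x; rewrite inE mem_cat.
lra.
Qed.

Lemma partial_sumE a : summability.partial_sum a = S a.
Proof. by apply/funext => A; rewrite [RHS]big_seq_fsetE. Qed.

(** The difference is a sum over the indices of [A'] outside [A], a set disjoint from [A0]. *)
Lemma weierstrass_finite_sums a M (e : R) (A0 : {fset I}) :
  (forall i, normc (a i) <= M i) ->
  (forall B : {fset I}, [disjoint A0 & B]%fset -> \sum_(i <- B) M i <= e) ->
  forall A A' : {fset I}, (A0 `<=` A)%fset -> (A `<=` A')%fset ->
  normc (\sum_(i <- A') a i - \sum_(i <- A) a i) <= e.
Proof.
move=> aM MB A A' A0A AA'.
have -> : \sum_(i <- A') a i = \sum_(i <- A) a i + \sum_(i <- (A' `\` A)%fset) a i.
  rewrite -big_cat; apply: perm_big; apply: uniq_perm => //.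
    rewrite cat_uniq !fset_uniq /= andbT; apply/hasPn => x.
    by rewrite inE => /andP[].
  move=> x; rewrite mem_cat inE; case: (boolP (x \in A)) => //= xA.
  by rewrite (fsubsetP AA').
rewrite addrC addKr; apply: le_trans (normc_sum _ _ _) _.
apply: le_trans (_ : _ <= \sum_(i <- (A' `\` A)%fset) M i) _; first exact: ler_sum.
apply: MB; apply/fdisjointP => x xA0; rewrite inE negb_and negbK.
by rewrite (fsubsetP A0A).
Qed.

(** [summability.sum] is a [lim], which is informative only once a limit exists; the Cauchy
    criterion provides one. *)
Lemma normc_summable_cvg a M : (forall i, normc (a i) <= M i) ->
  (\esum_(i in [set: I]) (M i)%:E < +oo)%E ->
  S a @ summability.totally --> (summability.sum a : C).
Proof.
move=> aM Mfin.
have M0 i : 0 <= M i by apply: le_trans (aM i); exact: normc_ge0.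
have [l al] : exists l : C, S a @ summability.totally --> l.
  apply: cauchy_cvgC => e e0.
  have e2 : 0 < e / 2 by rewrite divr_gt0.
  have [A0 hA0] := esum_tail M0 Mfin e2.
  exists A0; exists A0 => // A /= A0A; rewrite normcB.
  apply: le_lt_trans (weierstrass_finite_sums aM hA0 _ A0A) _ => //.
  by rewrite ltr_pdivrMr // ltr_pMr // ltr1n.
suff -> : summability.sum a = l by [].
by rewrite /summability.sum partial_sumE; apply: cvg_lim => //; exact: norm_hausdorff.
Qed.

Lemma weierstrass_test (T : Type) (K : set T) (a : T -> I -> C) M (e : R) :
  (forall t i, K t -> normc (a t i) <= M i) -> (forall i, 0 <= M i) ->
  (\esum_(i in [set: I]) (M i)%:E < +oo)%E -> 0 < e ->
  exists A0 : {fset I}, forall A : {fset I}, (A0 `<=` A)%fset ->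
    forall t, K t -> normc (summability.sum (a t) - \sum_(i <- A) a t i) < e.
Proof.
move=> aM M0 Mfin e0; have e2 : 0 < e / 2 by rewrite divr_gt0.
have [A0 hA0] := esum_tail M0 Mfin e2.
exists A0 => A A0A t Kt; have aMt i := aM t i Kt.
(* [A1] depends on [t], whereas [A0] depends on [M] and [e] only; [A1] enters just through the
   intermediate union. *)
have /cvg_normcP/(_ _ e2)[A1 _ hA1] := normc_summable_cvg aMt Mfin.
have h1 := hA1 (A `|` A1)%fset (fsubsetUr _ _).
have h2 := weierstrass_finite_sums aMt hA0 A0A (fsubsetUl A A1).
rewrite -(subrKA (\sum_(i <- (A `|` A1)%fset) a t i)) [ltRHS]splitr.
by apply: le_lt_trans (le_normcD _ _) _; exact: ltr_leD.
Qed.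

End Family.
End ComplexSums.

(** * Lattice points approximating prescribed directions *)

Section Lattice.
Context {R : realType} {N : nat}.
Implicit Types (x : 'rV[R]_N) (J : multi_index N).

Lemma mdeg_sum J : (mdeg J)%:R = \sum_i (J i)%:R :> R.
Proof. by rewrite natr_sum. Qed.

Lemma l1norm_mvec J : l1norm (mvec J : 'rV[R]_N) = (mdeg J)%:R.
Proof. by rewrite mdeg_sum; apply: eq_bigr => i _; rewrite mxE ger0_norm. Qed.

Lemma mdeg_gt0 J : J != [ffun=> 0%N] -> (0 < mdeg J)%N.
Proof.
move=> J0; rewrite lt0n; apply: contra_neq J0 => /eqP.
rewrite sum_nat_eq0 => /forallP J0; apply/ffunP => i; rewrite ffunE.
exact/eqP/(implyP (J0 i)).
Qed.

Lemma dot_mvec J x : J != [ffun=> 0%N] ->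
  dot (mvec J) x = (mdeg J)%:R * dot (l1proj (mvec J)) x.
Proof.
move=> /mdeg_gt0 J0; rewrite /l1proj dotZl l1norm_mvec mulVKf //.
by rewrite pnatr_eq0 -lt0n.
Qed.

Lemma normr_le_l1norm x : `|x| <= l1norm x.
Proof.
rewrite [leLHS]/Num.norm /= mx_normrE; apply/bigmax_leP.
split=> [|[i j] _ /=]; first exact: l1norm_ge0.
by rewrite ord1 /l1norm (bigD1 j) //= lerDl sumr_ge0.
Qed.

Lemma cvg_dot (T : Type) (F : set_system T) (FF : Filter F) (f : T -> 'rV[R]_N) x s :
  f @ F --> x -> (fun t => dot (f t) s) @ F --> dot x s.
Proof.
move=> fx; apply: cvg_big => [|i _]; first exact: add_continuous.
have fi : (fun t => f t 0 i) @ F --> x 0 i.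
  have := cvg_comp f (fun y : 'rV[R]_N => y 0 i) fx; apply; exact: coord_continuous.
exact: (@cvgM R T F FF _ _ _ _ fi (cvg_cst (s 0 i))).
Qed.

(** Multiples of [alpha n] rounded down. The code of the pair makes the factors distinct, and their
    spacing [N.+1] exceeds the total rounding loss, which is at most [N] for nonnegative
    [alpha n]. *)
Definition lattice_approx (alpha : nat -> 'rV[R]_N) (n k : nat) : multi_index N :=
  [ffun i => Num.truncn ((N.+1 * (choice.pickle (n, k)).+1)%:R * alpha n 0 i)].

Section Approx.
Variable alpha : nat -> 'rV[R]_N.
Hypothesis alpha_ge0 : forall n i, 0 <= alpha n 0 i.
Hypothesis alpha1 : forall n, l1norm (alpha n) = 1.
Local Notation J := (lattice_approx alpha).

Lemma lattice_approx_itv n k i :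
  (N.+1 * (choice.pickle (n, k)).+1)%:R * alpha n 0 i - 1 <= (J n k i)%:R
    <= (N.+1 * (choice.pickle (n, k)).+1)%:R * alpha n 0 i.
Proof.
set x := _ * alpha n 0 i.
have x0 : 0 <= x by rewrite mulr_ge0.
rewrite ffunE; have := truncn_itv x0; rewrite -/x => /andP[-> /ltW].
by rewrite -natr1 lerBlDr => ->.
Qed.

Lemma mdeg_lattice_approx n k (L := (N.+1 * (choice.pickle (n, k)).+1)%N) :
  (L <= mdeg (J n k) + N)%N && (mdeg (J n k) <= L)%N.
Proof.
have LE : L%:R = \sum_i L%:R * alpha n 0 i :> R.
  by rewrite -mulr_sumr -l1norm_nneg // alpha1 mulr1.
rewrite -!(ler_nat R) natrD mdeg_sum LE; apply/andP; split.
  rewrite -[X in _ + X%:R]card_ord -sumr_const -big_split ler_sum // => i _.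
  by have /andP[+ _] := lattice_approx_itv n k i; rewrite -/L /=; lra.
by apply: ler_sum => i _; have /andP[] := lattice_approx_itv n k i.
Qed.

(** The degree determines the pair: it lies at most [N] below a multiple of [N.+1], hence fixes that
    multiple, and [choice.pickle] is injective. *)
Lemma lattice_approx_inj n k n' k' : J n k = J n' k' -> n = n' /\ k = k'.
Proof.
move=> JJ; have := mdeg_lattice_approx n k; have := mdeg_lattice_approx n' k'.
rewrite JJ; set p := choice.pickle (n, k); set p' := choice.pickle (n', k').
set d := mdeg _ => /andP[a1 a2] /andP[b1 b2].
have : p = p'.
  have : (N.+1 * p.+1 < N.+1 * p'.+2)%N by rewrite (mulnS _ p'.+1); lia.
  have : (N.+1 * p'.+1 < N.+1 * p.+2)%N by rewrite (mulnS _ p.+1); lia.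
  by rewrite !ltn_pmul2l //; lia.
by move=> /(pcan_inj choice.pickleK)[-> ->].
Qed.

Lemma mdeg_lattice_approx_ge n k : (choice.pickle (n, k) < mdeg (J n k))%N.
Proof.
have /andP[+ _] := mdeg_lattice_approx n k; rewrite mulSn; set p := choice.pickle _.
by have := leq_pmulr N (ltn0Sn p); lia.
Qed.

(** Rounding costs at most [N], and so does replacing the factor [L] by the degree [m]; both are
    divided by [m], which exceeds the code of the pair. *)
Lemma lattice_approx_dist n k :
  l1norm (l1proj (mvec (J n k)) - alpha n) <= (2 * N)%:R / (choice.pickle (n, k)).+1%:R.
Proof.
set m := mdeg (J n k); set p := choice.pickle (n, k); set L := (N.+1 * p.+1)%N.
have pm : (p < m)%N := mdeg_lattice_approx_ge n k.
have m0 : 0 < m%:R :> R by rewrite ltr0n; exact: leq_ltn_trans pm.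
have -> : l1proj (mvec (J n k)) - alpha n = m%:R^-1 *: (mvec (J n k) - m%:R *: alpha n).
  by rewrite scalerBr scalerA mulVf ?gt_eqF // scale1r /l1proj l1norm_mvec.
rewrite l1normZ ger0_norm ?invr_ge0 ?(ltW m0) // mulrC.
apply: (@le_trans _ _ ((2 * N)%:R / m%:R)); last first.
  by rewrite ler_wpM2l // lef_pV2 ?posrE // ler_nat.
rewrite ler_wpM2r ?invr_ge0 ?(ltW m0) //.
have /andP[Lm mL] := mdeg_lattice_approx n k; rewrite -/m -/L in Lm mL.
rewrite -!(ler_nat R) natrD in Lm mL.
apply: (@le_trans _ _ (\sum_i ((L%:R - m%:R) * alpha n 0 i + 1))).
  apply: ler_sum => i _; rewrite !mxE.
  have /andP[] := lattice_approx_itv n k i; rewrite -/p -/L => h1 h2.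
  have h3 : 0 <= (L%:R - m%:R) * alpha n 0 i by rewrite mulr_ge0 // subr_ge0.
  by rewrite ler_norml; apply/andP; split; lra.
rewrite big_split /= -mulr_sumr -l1norm_nneg // alpha1 mulr1 sumr_const card_ord.
by rewrite natrM; lra.
Qed.

Lemma lattice_approx_jointly_convergent : jointly_convergent alpha J.
Proof.
move=> e e0; pose A := (2 * N)%:R / e.
apply: (@sub_finite_set _ _ (choice.pickle @^-1` `I_(Num.truncn A).+1)).
  move=> [n k] /= he; have := le_trans he (lattice_approx_dist n k).
  rewrite ler_pdivlMr // -ler_pdivlMl // mulrC -/A => pA.
  by rewrite ltnS; have := le_truncn pA; rewrite natrK; exact: ltnW.
apply: finite_preimage; last exact: finite_II.
by move=> x y _ _; exact: (pcan_inj choice.pickleK).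
Qed.

Lemma lattice_approx_admissible : admissible alpha J.
Proof.
split; first exact: lattice_approx_inj.
  move=> n k; have := mdeg_lattice_approx_ge n k; apply: contraTneq => ->.
  by rewrite /mdeg big1 // => i _; rewrite ffunE.
move=> n; apply/cvgrPdist_lt => e e0.
(* Convergence for fixed [n] is read off from joint convergence restricted to that row. *)
have /finite_fsetP[X XE] : finite_set [set k | e <= l1norm (l1proj (mvec (J n k)) - alpha n)].
  apply: (@finite_preimage _ _ _ (fun k => (n, k))) (lattice_approx_jointly_convergent e0).
  by move=> i j _ _ [].
exists (\max_(k <- X) k).+1 => // k /= Xk.
rewrite distrC; apply: le_lt_trans (normr_le_l1norm _) _.
rewrite ltNge; apply/negP => ke.
have kX : k \in X by have : [set` X] k by rewrite -XE.
have : (k <= \max_(j <- X) j)%N by exact: (leq_bigmax_seq k).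
by rewrite leqNgt Xk.
Qed.

End Approx.
End Lattice.

(** * Complete Reinhardt domains in logarithmic coordinates *)

Section Reinhardt.
Local Open Scope complex_scope.
Local Notation Re := complex.Re.
Local Notation Im := complex.Im.
Context {R : realType} {N : nat}.
Implicit Types (z w : Cspace R N) (D : set (Cspace R N)) (s : 'rV[R]_N).

(** A section of the logarithmic map: for a complete Reinhardt [D], membership of [s] in
    [log_image D] becomes membership of this point in [D]. *)
Definition cexp s : Cspace R N := \row_i (expR (s 0 i))%:C.

Lemma normc_cexp s i : normc (cexp s 0 i) = expR (s 0 i).
Proof. by rewrite mxE normcr ger0_norm ?expR_ge0. Qed.

Lemma cexp_neq0 s i : cexp s 0 i != 0.
Proof.
apply/eqP => s0; have := normc_cexp s i; rewrite s0 Normc.normc0 => /eqP.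
by rewrite eq_sym gt_eqF ?expR_gt0.
Qed.

Lemma normc_gt0 (x : R[i]) : (0 < normc x) = (x != 0).
Proof.
rewrite lt_neqAle normc_ge0 andbT eq_sym; congr (~~ _); apply/eqP/eqP.
  exact: Normc.eq0_normc.
by move=> ->; rewrite Normc.normc0.
Qed.

Lemma polydisc_open (r : 'rV[R]_N) : open (polydisc r : set (Cspace R N)).
Proof.
rewrite openE => z zr.
suff : \forall w \near z, forall i, normc ((w : Cspace R N) 0 i) < r 0 i by [].
apply: (@filter_forall _ _ (fun i (w : Cspace R N) => normc (w 0 i) < r 0 i) _ (nbhs_filter z)) => i.
have /cvg_normcP : (fun w : Cspace R N => w 0 i) @ z --> z 0 i.
  exact: coord_continuous.
move=> /(_ (r 0 i - normc (z 0 i))); rewrite subr_gt0 => /(_ (zr i)).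
apply: filterS => w; rewrite normcB ltrBrDl; apply: le_lt_trans.
by rewrite -{1}(subrKC (z 0 i) (w 0 i)); exact: le_normcD.
Qed.

(** Every coordinate is moved outward by [d]. The new point has no zero coordinate, so logarithms
    apply to it even where [z] vanishes. *)
Lemma interior_enlarge (A : set (Cspace R N)) z : A° z ->
  exists2 w, A w & forall i, normc (z 0 i) < normc (w 0 i).
Proof.
move=> /nbhs_ballP[e /= e0 eA].
have := e0; rewrite ltcE => /= /andP[/eqP ei er].
pose d := Re e / 2; have d0 : 0 < d by rewrite divr_gt0.
have de : d%:C < e.
  by rewrite ltcE /= ei eqxx /= ltr_pdivrMr // ltr_pMr // ltr1n.
pose w : Cspace R N := \row_i if z 0 i == 0 then d%:C
  else z 0 i * (1 + d / normc (z 0 i))%:C.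
exists w.
  apply: eA; split => // i j; rewrite ord1 /ball /= mxE; apply: le_lt_trans de.
  rewrite -[leLHS]/((normc _)%:C) lecR; case: eqVneq => [->|zj].
    by rewrite sub0r normcN normcr gtr0_norm.
  rewrite rmorphD mulrDr mulr1 opprD addNKr normcN Normc.normcM normcr.
  have z0 : 0 < normc (z 0 j) by rewrite normc_gt0.
  by rewrite gtr0_norm ?divr_gt0 // [leLHS]mulrC divfK ?gt_eqF.
move=> i; rewrite mxE; case: eqVneq => [->|zi].
  by rewrite Normc.normc0 normcr gtr0_norm.
have z0 : 0 < normc (z 0 i) by rewrite normc_gt0.
rewrite Normc.normcM normcr ltr_pMr // gtr0_norm; first by rewrite ltrDl divr_gt0.
by rewrite addr_gt0 // divr_gt0.
Qed.

Section Domain.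
Variable D : set (Cspace R N).
Hypothesis reinhardtD : complete_reinhardt D.

Lemma reinhardt_lower z w : D z -> (forall i, normc (w 0 i) <= normc (z 0 i)) -> D w.
Proof.
case: reinhardtD => P _ -> [r Pr rz] wz.
by exists r => // i; exact: le_lt_trans (rz i).
Qed.

Lemma log_imageP s : log_image D s <-> D (cexp s).
Proof.
split=> [[z [Dz /= z0] <-]|Ds].
  apply: (reinhardt_lower Dz) => i.
  by rewrite normc_cexp mxE lnK ?posrE // normc_gt0.
exists (cexp s); first by split => //= i; exact: cexp_neq0.
by apply/rowP => i; rewrite mxE normc_cexp expRK.
Qed.

(** The midpoints between the moduli of [z] and the radii of a polydisc containing [z] are positive
    even at zero coordinates. *)
Lemma reinhardt_log_majorant z :
  D z -> exists2 s, log_image D s & forall i, normc (z 0 i) < expR (s 0 i).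
Proof.
move=> Dz; case: (reinhardtD) => P P0 DE; have : D z := Dz; rewrite {1}DE => -[r Pr rz].
have avg0 i : 0 < (normc (z 0 i) + r 0 i) / 2.
  by rewrite divr_gt0 // ltr_wpDl ?normc_ge0 ?(P0 _ Pr).
exists (\row_i ln ((normc (z 0 i) + r 0 i) / 2)).
  apply/log_imageP; rewrite DE; exists r => // i.
  by rewrite normc_cexp mxE lnK ?posrE // midf_lt.
by move=> i; rewrite mxE lnK ?posrE // midf_lt.
Qed.

Lemma log_image_lower : lower_set (log_image D).
Proof.
move=> x y /log_imageP Dx yx; apply/log_imageP; apply: (reinhardt_lower Dx) => i.
by rewrite !normc_cexp ler_expR.
Qed.

Lemma log_image_up_open : up_open (log_image D).
Proof.
move=> x /log_imageP/reinhardt_log_majorant[s sG xs].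
have xs' i : x 0 i < s 0 i by have := xs i; rewrite normc_cexp ltr_expR.
have [e e0 es] := row_lt_gap xs'; exists e => //.
by apply: log_image_lower sG _ => i; rewrite !mxE.
Qed.

Lemma log_image_neq0 : D !=set0 -> log_image D !=set0.
Proof. by move=> [z /reinhardt_log_majorant[s sG _]]; exists s. Qed.

End Domain.
End Reinhardt.

(** * Moduli of monomials *)

Section Moduli.
Local Open Scope complex_scope.
Context {R : realType} {N : nat}.
Implicit Types (z w : Cspace R N).

Lemma normc_monom z J : normc (monom z J) = \prod_i normc (z 0 i) ^+ J i.
Proof.
rewrite /monom; elim/big_ind2 : _ => [|x1 x2 y1 y2 h1 h2|i _].
- exact: Normc.normc1.
- by rewrite Normc.normcM h1 h2.
- exact: normcX.
Qed.

Lemma normc_monom_le z (r : 'I_N -> R) J : (forall i, normc (z 0 i) <= r i) ->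
  normc (monom z J) <= \prod_i r i ^+ J i.
Proof.
move=> zr; rewrite normc_monom; apply: ler_prod => i _.
rewrite exprn_ge0 ?normc_ge0 //= lerXn2r // nnegrE ?normc_ge0 //.
apply: (le_trans _ (zr i)); exact: normc_ge0.
Qed.

Lemma abs_converges_modulus (c : Defs.pseries R N) z w :
  (forall i, normc (w 0 i) = normc (z 0 i)) -> abs_converges c z -> abs_converges c w.
Proof.
move=> wz; rewrite /abs_converges.
under [X in _ -> (X < _)%E]eq_esum => J _.
  rewrite Normc.normcM normc_monom; under eq_bigr do rewrite wz.
  rewrite -normc_monom -Normc.normcM; over.
by [].
Qed.

End Moduli.

(** * Power series along an injective family of exponents *)

Section PowerSeries.
Local Open Scope complex_scope.
Context {R : realType} {N : nat} {I : choiceType}.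
Variables (E : I -> multi_index N) (c : I -> R).
Hypothesis Einj : injective E.
Implicit Types (z : Cspace R N).

Lemma pseries_of_inj i : pseries_of E c (E i) = (c i)%:C.
Proof.
rewrite /pseries_of (_ : _ @^-1` _ = [set i]) ?fsbig_set1 //.
by apply/seteqP; split => j /= => [/Einj|->].
Qed.

Lemma pseries_of_notin J : ~ range E J -> pseries_of E c J = 0.
Proof.
move=> EJ; rewrite /pseries_of (_ : _ @^-1` _ = set0) ?fsbig_set0 //.
by apply/seteqP; split => j //= EjJ; apply: EJ; exists j.
Qed.

Lemma esum_pseries_of z :
  \esum_(J in [set: multi_index N]) (normc (pseries_of E c J * monom z J))%:E =
  \esum_(i in [set: I]) (normc ((c i)%:C * monom z (E i)))%:E.
Proof.
rewrite -(eq_esum (a := fun i => (normc (pseries_of E c (E i) * monom z (E i)))%:E)).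
  have ET : set_inj [set: I] E by move=> i j _ _; exact: Einj.
  rewrite -(@esum_image R _ _ setT E
    (fun J => (normc (pseries_of E c J * monom z J))%:E) ET) [RHS]esum_mkcond.
  apply: eq_esum => J _; case: ifPn => // /negP; rewrite inE => EJ.
  by rewrite pseries_of_notin // mul0r Normc.normc0.
by move=> i _; rewrite pseries_of_inj.
Qed.

Lemma pseries_sum_of z : abs_converges (pseries_of E c) z ->
  pseries_sum (pseries_of E c) z =
  summability.sum (fun i => (c i)%:C * monom z (E i) : R[i]^o).
Proof.
rewrite /abs_converges esum_pseries_of => cz.
have /cvg_normcP sz := normc_summable_cvg (fun i => lexx _) cz.
rewrite /pseries_sum /summability.sum; apply: (cvg_lim (@norm_hausdorff _ _)).
rewrite partial_sumE; apply/cvg_normcP => e e0; have [A0 _ hA0] := sz e e0.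
exists (E @` A0)%fset => // B /= EB.
have finB : finite_set (E @^-1` [set` B]).
  by apply: finite_preimage => // i j _ _; exact: Einj.
pose A := fset_set (E @^-1` [set` B]).
have AP i : (i \in A) = (E i \in B) by rewrite in_fset_set // mem_setE.
have := hA0 A; rewrite (_ : \sum_(i <- A) _ =
    \sum_(J <- B) pseries_of E c J * monom z J); first apply.
  by apply/fsubsetP => i iA0; rewrite AP; apply: (fsubsetP EB); rewrite in_imfset.
rewrite -(@big_fset_incl _ _ _ _ (E @` A)%fset).
- rewrite big_imfset /=; last by move=> i j _ _; exact: Einj.
  by apply: eq_bigr => i _; rewrite pseries_of_inj.
- by apply/fsubsetP => _ /imfsetP[i /= iA ->]; rewrite -AP.
- move=> J JB JA; rewrite pseries_of_notin ?mul0r // => -[i _ iJ].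
  by move/negP: JA; apply; rewrite -iJ; apply: in_imfset; rewrite /= AP iJ.
Qed.

End PowerSeries.

(** * Terms in exponential form *)

Section ExponentialTerms.
Local Open Scope complex_scope.
Context {R : realType} {N : nat}.
Implicit Types (z : Cspace R N) (s : 'rV[R]_N) (J : multi_index N).

Definition exp_term J (b : R) s : R :=
  expR ((mdeg J)%:R * (dot (l1proj (mvec J)) s - b)).

Lemma exp_termE J b s : J != [ffun=> 0%N] ->
  expR (- ((mdeg J)%:R * b)) * \prod_i expR (s 0 i) ^+ J i = exp_term J b s.
Proof.
move=> J0; rewrite /exp_term mulrBr -dot_mvec // addrC expRD; congr (_ * _).
rewrite /dot expR_sum; apply: eq_bigr => i _.
by rewrite mxE expRM_natl.
Qed.

Lemma normc_term_le J b s z : J != [ffun=> 0%N] ->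
  (forall i, normc (z 0 i) <= expR (s 0 i)) ->
  normc ((expR (- ((mdeg J)%:R * b)))%:C * monom z J) <= exp_term J b s.
Proof.
move=> J0 zs; rewrite Normc.normcM normcr ger0_norm ?expR_ge0 // -exp_termE //.
rewrite ler_wpM2l ?expR_ge0 //.
exact: (normc_monom_le (r := fun i => expR (s 0 i))).
Qed.

Lemma normc_term_cexp J b s : J != [ffun=> 0%N] ->
  normc ((expR (- ((mdeg J)%:R * b)))%:C * monom (cexp s) J) = exp_term J b s.
Proof.
move=> J0; rewrite Normc.normcM normcr ger0_norm ?expR_ge0 // -exp_termE //.
by rewrite normc_monom; under eq_bigr do rewrite normc_cexp.
Qed.

Context {I : choiceType}.
Variables (E : I -> multi_index N) (b : I -> R).
Hypothesis Einj : injective E.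
Hypothesis E_neq0 : forall i, E i != [ffun=> 0%N].
Local Notation F := (pseries_of E (fun i => expR (- ((mdeg (E i))%:R * b i)))).
Local Notation M s := (fun i => exp_term (E i) (b i) s).

(** Outside the finite set the bracket is at most [- d], so the terms have the geometric majorant
    [expR (- d) ^+ mdeg (E i)]. *)
Lemma exp_term_summable s (d : R) : 0 < d ->
  finite_set [set i | - d < dot (l1proj (mvec (E i))) s - b i] ->
  (\esum_(i in [set: I]) (M s i)%:E < +oo)%E.
Proof.
move=> d0 finB; have q01 : 0 <= expR (- d) < 1 by rewrite expR_ge0 expR_lt1 oppr_lt0.
apply: (esum_geometric_majorant q01 Einj) => [i|]; first exact: expR_ge0.
apply: sub_finite_set finB => i /=; rewrite /exp_term -expRM_natl ltr_expR.
by rewrite ltr_pM2l // ltr0n mdeg_gt0.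
Qed.

Lemma abs_converges_exp_term s z : (forall i, normc (z 0 i) <= expR (s 0 i)) ->
  (\esum_(i in [set: I]) (M s i)%:E < +oo)%E -> abs_converges F z.
Proof.
move=> zs Ms; rewrite /abs_converges esum_pseries_of //; apply: le_lt_trans Ms.
by apply: le_esum => i _; rewrite lee_fin; exact: normc_term_le.
Qed.

(** If [B < x], the bracket is eventually positive along [g], so infinitely many terms have modulus
    at least 1. Choosing [g] to run through one row serves each component series and the total
    series alike. *)
Lemma abs_converges_cexp_bound s (g : nat -> I) (x : R) (B : R) : injective g ->
  (fun k => dot (l1proj (mvec (E (g k)))) s) @ \oo --> x ->
  (forall k, b (g k) = B) -> abs_converges F (cexp s) -> x <= B.
Proof.
move=> ginj gx gB; rewrite /abs_converges esum_pseries_of //.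
under eq_esum do rewrite normc_term_cexp //.
apply: contraTT; rewrite -ltNge => Bx.
have := gx; move=> /cvgrPdist_lt/(_ (x - B)); rewrite subr_gt0 => /(_ Bx)[k0 _ hk0].
rewrite (@esum_ge1_pinfty _ _ _ g k0) // => [i|k k0k]; first exact: expR_ge0.
rewrite /exp_term -[leLHS]expR0 ler_expR mulr_ge0 // subr_ge0 gB.
have /= := hk0 k k0k.
by rewrite ltr_norml => /andP[_]; lra.
Qed.

End ExponentialTerms.

(** * Uniform convergence and iterated sums *)

Section UniformConvergence.
Local Open Scope complex_scope.
Context {R : realType} {T : choiceType}.

Lemma uniform_normcP (K : set T) (F : set_system (T -> R[i]^o)) {FF : Filter F}
    (f : T -> R[i]^o) :
  (forall e : R, 0 < e -> \forall g \near F, forall t, K t -> normc (f t - g t) < e) ->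
  {uniform K, F --> f}.
Proof.
move=> Ff P /uniform_nbhs[U [entU UP]]; apply: filterS UP _.
move: entU; rewrite -entourage_from_ballE => -[e /= e0 eU].
have := e0; rewrite ltcE => /= /andP[/eqP ei er].
apply: filterS (Ff _ er) => g fg t Kt; apply: eU => /=.
by rewrite /ball /= ltcE /= ei eqxx /=; exact: fg.
Qed.

(* The finite set [A] of pairs approximating the total sum is enlarged to
   [`I_n * B], with [B] chosen so that each of the [n] partial row sums over [B]
   is close to the corresponding row sum. *)
Lemma iterated_sum_cvg (a : nat * nat -> R[i]^o) (M : nat * nat -> R) :
  (forall p, normc (a p) <= M p) ->
  (\esum_(p in [set: nat * nat]) (M p)%:E < +oo)%E ->
  (forall n, (\esum_(k in [set: nat]) (M (n, k))%:E < +oo)%E) ->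
  series (fun n => summability.sum (fun k => a (n, k)) : R[i]^o) @ \oo -->
    (summability.sum a : R[i]^o).
Proof.
move=> aM Mfin Mfin1; apply/cvg_normcP => e e0.
have e2 : 0 < e / 2 by rewrite divr_gt0.
have /cvg_normcP/(_ _ e2)[A _ hA] := normc_summable_cvg aM Mfin.
(* From here on [n] exceeds all row indices occurring in [A]. *)
exists (\max_(p <- A) p.1).+1 => // n /= An.
(* The errors of [n] rows then add up to at most [e / 2]. *)
pose e' := e / 2 / n.+1%:R; have e'0 : 0 < e' by rewrite divr_gt0.
pose P (m : nat) (B : {fset nat}) :=
  normc (summability.sum (fun k => a (m, k)) - \sum_(k <- B) a (m, k)) < e'.
have [B0 _ hB0] : \forall B \near @summability.totally nat, forall m : 'I_n, P m B.
  apply: (@filter_forall _ _ (fun (m : 'I_n) => P m)) => m.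
  have := normc_summable_cvg (fun k => aM (m : nat, k)) (Mfin1 m).
  by move=> /cvg_normcP/(_ _ e'0).
pose B := (B0 `|` [fset p.2 | p in A])%fset.
have hB m : (m < n)%N -> P m B.
  by move=> mn; have := hB0 B (fsubsetUl _ _) (Ordinal mn).
pose nB := [fset p | p in [seq (m, k) | m <- iota 0 n, k <- B]]%fset.
have := hA nB; rewrite (_ : \sum_(i <- nB) a i =
    \sum_(0 <= m < n) \sum_(k <- B) a (m, k)); last first.
  transitivity (\sum_(p <- [seq (m, k) | m <- iota 0 n, k <- B]) a p).
    apply: perm_big; apply: uniq_perm => // [|p]; last by rewrite !inE.
    by apply: allpairs_uniq; rewrite ?iota_uniq ?fset_uniq // => -[? ?] [? ?].
  by rewrite big_allpairs /index_iota subn0.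
have AnB : (A `<=` nB)%fset.
  apply/fsubsetP => -[m k] mkA; rewrite !inE /=; apply/allpairsP; exists (m, k).
  split => //=.
    rewrite mem_iota add0n; apply: leq_ltn_trans An.
    exact: (leq_bigmax_seq (m, k)).
  by rewrite inE; apply/orP; right; apply/imfsetP; exists (m, k).
move=> /(_ AnB); rewrite /series /= => h1.
rewrite -(subrKA (\sum_(0 <= m < n) \sum_(k <- B) a (m, k))) [ltRHS]splitr.
apply: le_lt_trans (le_normcD _ _) _; apply: ltr_leD => //.
rewrite -sumrB; apply: le_trans (normc_sum _ _ _) _.
apply: (@le_trans _ _ (\sum_(0 <= m < n) e')).
  rewrite big_nat [leRHS]big_nat; apply: ler_sum => m /andP[_ mn].
  by rewrite normcB ltW //; exact: hB.
rewrite sumr_const_nat subn0 -[leLHS]mulr_natr /e' [leLHS]mulrAC ler_pdivrMr //.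
by rewrite ler_pM2l // ler_nat.
Qed.

End UniformConvergence.

(** * The component series and the total series of the domain *)

Section Main.
Context {R : realType} {N : nat}.
Variables (D : set (Cspace R N)) (alpha : nat -> 'rV[R]_N).
Variable J : nat -> nat -> multi_index N.
Implicit Types (z w : Cspace R N) (s : 'rV[R]_N).
Hypotheses (reinhardtD : complete_reinhardt D) (convexD : log_convex D).
Hypothesis D0 : D !=set0.
Local Notation G := (log_image D).
Local Notation h := (support_function G).
Local Notation PSh := (normalized_eff_domain h).
Hypotheses (alphaP : range alpha `<=` PSh) (alpha_dense : PSh `<=` closure (range alpha)).
Hypothesis J_adm : admissible alpha J.

Let Glow := log_image_lower reinhardtD.
Let Gup := log_image_up_open reinhardtD.
Let G0 : G !=set0 := log_image_neq0 reinhardtD D0.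
Let alphaPSh n : PSh (alpha n). Proof. by apply: alphaP; exists n. Qed.
Let hfin n : h (alpha n) \is a fin_num. Proof. by case: (alphaPSh n). Qed.
Let alpha1 n : l1norm (alpha n) = 1. Proof. by case: (alphaPSh n). Qed.
Let alpha_ge0 n i : 0 <= alpha n 0 i.
Proof. exact: eff_domain_ge0 G0 Glow (alphaPSh n). Qed.
Let J_inj n : injective (J n).
Proof. by case: J_adm => Jinj _ _ k k' /Jinj[]. Qed.
Let Jp_inj : injective (fun p : nat * nat => J p.1 p.2).
Proof. by case: J_adm => Jinj _ _ [n k] [n' k'] /Jinj /= [-> ->]. Qed.
Let J_neq0 n k : J n k != [ffun=> 0%N].
Proof. by case: J_adm => _ + _; apply. Qed.
Let cvg_dirs n s : (fun k => dot (l1proj (mvec (J n k))) s) @ \oo --> dot (alpha n) s.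
Proof. by apply: cvg_dot; case: J_adm => _ _; apply. Qed.

Local Notation fn n := (component_series alpha J h n).
Local Notation f := (total_series alpha J h).

Lemma component_term_summable n s : dot (alpha n) s < fine (h (alpha n)) ->
  (\esum_(k in [set: nat]) (exp_term (J n k) (fine (h (alpha n))) s)%:E < +oo)%E.
Proof.
(* The bracket tends to [- 2 * d], hence is eventually below [- d]. *)
move=> sh; pose d := (fine (h (alpha n)) - dot (alpha n) s) / 2.
have d0 : 0 < d by rewrite divr_gt0 // subr_gt0.
apply: (exp_term_summable (E := J n) (b := fun=> fine (h (alpha n))) (@J_inj n) (J_neq0 n) d0).
have /cvgrPdist_lt/(_ _ d0)[k0 _ hk0] := cvg_dirs (n := n) (s := s).
apply: (@sub_finite_set _ _ `I_k0); last exact: finite_II.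
move=> k /= hk; rewrite ltnNge; apply/negP => /hk0 /=.
rewrite ltr_norml => /andP[+ _]; rewrite /d in hk *; lra.
Qed.

Lemma component_abs_converges n s z : dot (alpha n) s < fine (h (alpha n)) ->
  (forall i, normc (z 0 i) <= expR (s 0 i)) -> abs_converges (fn n) z.
Proof.
move=> sh zs; apply: (abs_converges_exp_term _ _ zs (component_term_summable sh)).
- exact: J_inj.
- exact: J_neq0.
Qed.

Lemma component_abs_converges_bound n s :
  abs_converges (fn n) (cexp s) -> dot (alpha n) s <= fine (h (alpha n)).
Proof.
apply: (abs_converges_cexp_bound (g := id) _ _ _ (@cvg_dirs n s)) => //.
Qed.

(** Convergence at a point gives a weak inequality; at an interior point it becomes strict by
    passing to larger moduli. Conversely, half of a strict margin leaves a polydisc of convergence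
    around [cexp s]. *)
Lemma log_image_component n :
  log_image (domain_of_convergence (fn n)) = supporting_half_space_at G (alpha n).
Proof.
rewrite supporting_half_space_atE //.
apply/seteqP; split=> [_ [z [zI /= z0] <-]|s /= sh].
  have [w wconv zw] := interior_enlarge zI.
  have w0 i : 0 < normc (w 0 i) by apply: le_lt_trans (zw i); exact: normc_ge0.
  set s := \row_i _.
  pose t : 'rV[R]_N := \row_i ln (normc (w 0 i)).
  have st i : s 0 i < t 0 i by rewrite !mxE ltr_ln ?posrE // normc_gt0.
  apply: (lt_le_trans (dot_lt (alpha_ge0 n) (alpha1 n) st)).
  apply: component_abs_converges_bound; apply: abs_converges_modulus wconv => i.
  by rewrite normc_cexp mxE lnK ?posrE.
pose e := (fine (h (alpha n)) - dot (alpha n) s) / 2.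
have e0 : 0 < e by rewrite divr_gt0 // subr_gt0.
exists (cexp s); last by apply/rowP => i; rewrite mxE normc_cexp expRK.
split; last by move=> i /=; exact: cexp_neq0.
pose t := s + const_mx e.
have th : dot (alpha n) t < fine (h (alpha n)).
  rewrite dotDr (dotC _ (const_mx _)) dot_const // alpha1 mulr1 /e; lra.
apply: (@filterS _ _ _ (polydisc (\row_i expR (t 0 i)))).
  move=> w /= wt; apply: component_abs_converges th _ => i.
  by have := wt i; rewrite mxE => /ltW.
apply: open_nbhs_nbhs; split; first exact: polydisc_open.
by move=> i; rewrite normc_cexp !mxE ltr_expR ltrDl.
Qed.

Lemma component_abs_converges_on n z : D z -> abs_converges (fn n) z.
Proof.
move=> /(reinhardt_log_majorant reinhardtD)[s sG zs].
apply: (component_abs_converges (s := s)) => [|i]; last exact: ltW.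
have [e e0 he] := eff_domain_gap Glow Gup sG.
by apply: lt_le_trans (he _ (alphaPSh n)); rewrite ltrDl.
Qed.

(** Convergence at an enlarged point [w] gives the inequalities of all [alpha n] at its logarithm
    [s], which places every point strictly below [s] in [G]. *)
Lemma total_domain_sub : domain_of_convergence f `<=` D.
Proof.
move=> z /interior_enlarge[w wconv zw].
have w0 i : 0 < normc (w 0 i) by apply: le_lt_trans (zw i); exact: normc_ge0.
pose s : 'rV[R]_N := \row_i ln (normc (w 0 i)).
have sconv : abs_converges f (cexp s).
  apply: abs_converges_modulus wconv => i.
  by rewrite normc_cexp mxE lnK ?posrE.
have sh n : dot (alpha n) s <= fine (h (alpha n)).
  apply: (abs_converges_cexp_bound (b := fun p : nat * nat => fine (h (alpha p.1)))
    (g := fun k => (n, k)) Jp_inj _ _ (@cvg_dirs n s)) sconv => //.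
  by move=> k k' [].
have avg0 i : 0 < (normc (z 0 i) + normc (w 0 i)) / 2.
  by rewrite divr_gt0 // ltr_wpDl ?normc_ge0.
(* The means stay positive where [z] has zero coordinates, and lie strictly between the moduli of
   [z] and [w]. *)
pose t : 'rV[R]_N := \row_i ln ((normc (z 0 i) + normc (w 0 i)) / 2).
have tG : G t.
  apply: (dense_support_lower convexD G0 Glow alphaP alpha_dense sh) => i.
  by rewrite !mxE ltr_ln ?posrE // midf_lt.
apply: (reinhardt_lower reinhardtD (z := cexp t)); first exact/log_imageP.
by move=> i; rewrite normc_cexp mxE lnK ?posrE // ltW // midf_lt.
Qed.

Section JointConvergence.
Hypothesis J_joint : jointly_convergent alpha J.

Local Notation M s := (fun p : nat * nat =>
  exp_term (J p.1 p.2) (fine (h (alpha p.1))) s).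

(** By the gap [e], a bracket above [- (e / 2)] makes the direction of [J n k] exceed [alpha n] by
    more than [e / 2] in the pairing with [s]. Their distance is then at least
    [e / 2 / (1 + l1norm s)], where the 1 avoids a zero divisor; joint convergence leaves finitely
    many such pairs. *)
Lemma total_term_summable s : G s ->
  (\esum_(p in [set: nat * nat]) (M s p)%:E < +oo)%E.
Proof.
move=> sG; have [e e0 he] := eff_domain_gap Glow Gup sG.
have e2 : 0 < e / 2 by rewrite divr_gt0.
apply: (exp_term_summable (E := fun p : nat * nat => J p.1 p.2)
  (b := fun p => fine (h (alpha p.1))) Jp_inj _ e2) => [p|]; first exact: J_neq0.
have s1 : 0 < 1 + l1norm s by rewrite ltr_pwDl // l1norm_ge0.
apply: sub_finite_set (J_joint (divr_gt0 e2 s1)) => -[n k] /= hnk.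
rewrite ler_pdivrMr //.
have := dot_le_norm (l1proj (mvec (J n k)) - alpha n) s.
rewrite ler_norml => /andP[_]; rewrite dotBl.
have := he _ (alphaPSh n).
have := l1norm_ge0 (l1proj (mvec (J n k)) - alpha n).
set x := l1norm (_ - _); set y := dot (l1proj _) s in hnk *.
rewrite mulrDr mulr1; lra.
Qed.

Lemma total_abs_converges z : D z -> abs_converges f z.
Proof.
move=> /(reinhardt_log_majorant reinhardtD)[s sG zs].
apply: (abs_converges_exp_term Jp_inj _ (s := s)).
- by move=> p; exact: J_neq0.
- by move=> i; exact: ltW.
- exact: total_term_summable.
Qed.

Lemma total_series_cvg z : D z ->
  series (fun n => pseries_sum (fn n) z) @ \oo --> pseries_sum f z.
Proof.
move=> Dz; have [s sG zs] := reinhardt_log_majorant reinhardtD Dz.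
rewrite (pseries_sum_of Jp_inj (total_abs_converges Dz)).
under [X in series X]eq_fun do
  rewrite (pseries_sum_of (@J_inj _) (component_abs_converges_on _ Dz)).
apply: (iterated_sum_cvg (M := M s)) => [p||n].
- by apply: normc_term_le => // i; exact: ltW.
- exact: total_term_summable.
- apply: component_term_summable; have [e e0 he] := eff_domain_gap Glow Gup sG.
  by apply: lt_le_trans (he _ (alphaPSh n)); rewrite ltrDl.
Qed.

(** Compactness reduces the claim to a neighbourhood of each [z]: on the polydisc of radii
    [expR (s 0 i)] the family [M s] is a summable majorant. *)
Lemma total_series_uniform (K : set (Cspace R N)) : compact K -> K `<=` D ->
  {uniform K, finite_partial_sum (fun p : nat * nat => J p.1 p.2)
      (fun p => coef alpha J h p.1 p.2) @ summability.totally --> pseries_sum f}.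
Proof.
move=> /compact_near_coveringP Kcov KD; apply: uniform_normcP => e e0.
apply: (Kcov _ summability.totally (fun A z => normc (pseries_sum f z -
  finite_partial_sum (fun p : nat * nat => J p.1 p.2)
    (fun p => coef alpha J h p.1 p.2) A z) < e)).
move=> z Kz; have [s sG zs] := reinhardt_log_majorant reinhardtD (KD z Kz).
pose U : set (Cspace R N) := polydisc (\row_i expR (s 0 i)).
have UD w : U w -> D w.
  move=> Uw; move/(log_imageP reinhardtD): sG => Ds.
  apply: (reinhardt_lower reinhardtD Ds) => i.
  by have := Uw i; rewrite normc_cexp mxE => /ltW.
pose term w (p : nat * nat) : R[i]^o :=
  (coef alpha J h p.1 p.2)%:C%C * monom w (J p.1 p.2).
have termM w p : U w -> normc (term w p) <= M s p.
  by move=> Uw; apply: normc_term_le => // i; have := Uw i; rewrite mxE => /ltW.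
have M0 p : 0 <= M s p by exact: expR_ge0.
have [A0 hA0] := weierstrass_test termM M0 (total_term_summable sG) e0.
exists (U, [set A | (A0 `<=` A)%fset]).
  split=> /=; last by exists A0.
  apply: open_nbhs_nbhs; split; first exact: polydisc_open.
  by move=> i; rewrite mxE.
move=> [w A] [/= Uw A0A].
by rewrite (pseries_sum_of Jp_inj (total_abs_converges (UD w Uw))); exact: hA0.
Qed.

End JointConvergence.
End Main.

Theorem theorem1p5 (R : realType) (N : nat) (D : set (Cspace R N))
    (alpha : nat -> 'rV[R]_N)
    (domD : is_domain D) (properD : D `<` setT)
    (reinhardtD : complete_reinhardt D) (convexD : log_convex D) :
  let G := log_image D in
  let h := support_function G in
  let PSh := normalized_eff_domain h in
  range alpha `<=` PSh -> PSh `<=` closure (range alpha) ->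
  (exists2 J, admissible alpha J & jointly_convergent alpha J) /\
  forall J : nat -> nat -> multi_index N, admissible alpha J ->
    let c := coef alpha J h in
    let fn := component_series alpha J h in
    let f := total_series alpha J h in
    [/\ forall n,
          [/\ forall k, 0 < c n k,
              elementary (fn n),
              supporting_half_space G (log_image (domain_of_convergence (fn n)))
            & forall z, D z -> abs_converges (fn n) z],
        domain_of_convergence f `<=` D
      & jointly_convergent alpha J ->
          [/\ forall z, D z -> abs_converges f z,
              forall z, D z ->
                series (fun n => pseries_sum (fn n) z) @ \oo --> pseries_sum f z,
              forall K : set (Cspace R N), compact K -> K `<=` D ->
                {uniform K, finite_partial_sum (fun p : nat * nat => J p.1 p.2)
                              (fun p => c p.1 p.2) @ summability.totally
                            --> pseries_sum f}
            & domain_of_convergence f = D]].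
Proof.
case: (domD) => D0 openD _ G h PSh alphaP alpha_dense.
have G0 : G !=set0 by exact: log_image_neq0.
have Glow := log_image_lower reinhardtD.
have alphaPSh n : PSh (alpha n) by apply: alphaP; exists n.
have alpha1 n : l1norm (alpha n) = 1 by case: (alphaPSh n).
have alpha_ge0 n i : 0 <= alpha n 0 i by exact: eff_domain_ge0 G0 Glow (alphaPSh n).
split.
  exists (lattice_approx alpha); first exact: lattice_approx_admissible.
  exact: lattice_approx_jointly_convergent.
move=> J J_adm c fn f.
have hE n : log_image (domain_of_convergence (fn n)) = supporting_half_space_at G (alpha n).
  exact: log_image_component.
split=> [n||J_joint].
- split=> [k|||z Dz].
  + exact: expR_gt0.
  + left; rewrite hE; exists (alpha n), (fine (h (alpha n))); split.
      apply: contra_eq_neq (alpha1 n) => ->.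
      by rewrite /l1norm big1 ?(eq_sym 0) ?oner_eq0 // => i _; rewrite mxE normr0.
    by have [_ hfin] := alphaPSh n; exact: supporting_half_space_atE hfin.
  + by rewrite hE; exists (alpha n); first exact: alphaPSh.
  + exact: component_abs_converges_on.
- exact: total_domain_sub.
- have convD z : D z -> abs_converges f z by exact: total_abs_converges.
  split=> [//|z Dz|K Kc KD|].
  + exact: total_series_cvg.
  + exact: total_series_uniform.
  + apply/seteqP; split; first exact: total_domain_sub.
    (* Openness of [D] turns absolute convergence on [D] into inclusion in the interior. *)
    by rewrite /domain_of_convergence -open_subsetE.
Qed.
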